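(* Let $X=X_\Sigma$ be a semiprojective toric variety with simplicial fan $\Sigma$, and let $k=|\Sigma(1)|$. Let $\Theta=\Theta_X$ be the Bondal-Thomsen collection of $X$, let $d\in-\Theta$, and suppose that $\tau$ is the minimal face of the effective cone $\mathrm{Eff}(X)$ containing the image of $d$ in the real class group $\mathrm{Cl}(X)\otimes\mathbb{R}$. Then $$\dim\tau+\dim S_d=k-|J_{S_d}|,$$ where $S_d$ is the $\Phi$-stratum of the Bondal stratification corresponding to $-d\in\Theta$. Moreover, $\tau$ is naturally identified with the effective cone of a $\dim(S_d)$-dimensional toric variety whose Bondal-Thomsen collection is in bijection with the subset of $\Theta_X$ corresponding to $\Phi$-strata $S$ with $J_{S_d}\subseteq J_S$.
   Context: $X_\Sigma$ is the toric variety of a fan $\Sigma$ in $N_{\mathbb{R}}=N\otimes\mathbb{R}$, where $N\cong\mathbb{Z}^n$ has dual lattice $M$; $\Sigma(1)=\{\rho_1,\dots,\rho_k\}$ is the set of rays, and $v_j\in N$ is the primitive generator of $\rho_j$. Semiprojective means that $X$ is projective over $\mathrm{Spec}\,\Gamma(X,\mathcal{O}_X)$ and has a torus-fixed point; in particular $v_1,\dots,v_k$ span $N_{\mathbb{R}}$. Let $M_{\mathbb{R}}=M\otimes\mathbb{R}$ and define $\varphi:M_{\mathbb{R}}\to\mathbb{R}^k$ by $\varphi(u)_j=\langle u,v_j\rangle$. Its cokernel $\pi:\mathbb{R}^k\to\mathbb{R}^k/\mathrm{im}(\varphi)$ is identified with the map from real torus-invariant divisors to the real class group $\mathrm{Cl}(X)\otimes\mathbb{R}$,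 where $\mathrm{Cl}(X)=\mathbb{Z}^k/\varphi(M)$. The effective cone is $\mathrm{Eff}(X)=\pi(\mathbb{R}_{\ge0}^k)\subseteq\mathrm{Cl}(X)\otimes\mathbb{R}$. The half-open zonotope is $Z=\pi([0,1)^k)$. The Bondal-Thomsen collection $\Theta=\Theta_X$ is the set of elements of $\mathrm{Cl}(X)$ whose image in $\mathrm{Cl}(X)\otimes\mathbb{R}$ lies in $-Z$; thus $d\in-\Theta$ if and only if the image of $d$ lies in $Z$. The effective cone and Bondal-Thomsen collection of another toric variety are defined in the same way from the rays of its fan. Let $\varphi^{-1}(\mathbb{Z}^k)=\{u\in M_{\mathbb{R}}:\varphi(u)\in\mathbb{Z}^k\}$, and let $h_j:M_{\mathbb{R}}/\varphi^{-1}(\mathbb{Z}^k)\to\mathbb{R}/\mathbb{Z}$ be induced by $\langle\cdot,v_j\rangle$. (When $\Sigma$ contains a smooth maximal-dimensional cone, $\varphi^{-1}(\mathbb{Z}^k)=M$.) Let $\Phi:M_{\mathbb{R}}\to\mathbb{Z}^k$ be $\Phi(u)_j=\lceil\langle u,v_j\rangle\rceil$. The $\Phi$-strata (the Bondal stratification) are the images in $M_{\mathbb{R}}/\varphi^{-1}(\mathbb{Z}^k)$ of the nonempty sets $\Phi^{-1}(c)$, $c\in\mathbb{Z}^k$. The map sending a $\Phi$-stratum $S$ to $\pi(\Phi(u))$, for any $u\in M_{\mathbb{R}}$ whose class lies in $S$, is a well-defined bijection from the $\Phi$-strata to $Z\cap\pi(\mathbb{Z}^k)$. An element $\theta\in\Theta$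 corresponds to the $\Phi$-stratum sent by this bijection to the image of $-\theta$; so $S_d$, the stratum corresponding to $-d\in\Theta$, is the one sent to the image of $d$. For a $\Phi$-stratum $S$, $J_S=\{j\in\{1,\dots,k\}:S\subseteq h_j^{-1}(0)\}$, and $\dim S$ is the dimension of the affine hull of any nonempty $\Phi^{-1}(c)$ with image $S$. The natural identification arises as follows. Put $W=\{w\in M_{\mathbb{R}}:\langle w,v_j\rangle=0\text{ for all }j\in J_{S_d}\}$ and let $\tilde\varphi:W\to\mathbb{R}^{k-|J_{S_d}|}$ be given by pairing with the $v_j$, $j\notin J_{S_d}$. The inclusion of $\mathbb{R}^{k-|J_{S_d}|}$ into $\mathbb{R}^k$ as the subspace where all coordinates in $J_{S_d}$ vanish induces an injective linear map $\mathrm{coker}(\tilde\varphi)\to\mathrm{coker}(\varphi)=\mathrm{Cl}(X)\otimes\mathbb{R}$; the toric variety in the claim is one whose rays are given by the images of the $\rho_j$, $j\notin J_{S_d}$, in the quotient $N/\mathrm{span}_{\mathbb{Z}}(v_j: j\in J_{S_d})$, and its effective cone is identified with $\tau$ through this injection.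
   Formalization: ''Toric variety'' in the last claim is taken as toric data (a fan with marked elements) over N/span(v_j : j in J), allowing torsion and zero, non-primitive or repeated ray images; with an actual toric variety the claim fails, e.g. P^1×P^1 blown up at a fixed point with J={(0,1),(0,-1)}. *)

(* Defs.v *)
From HB Require Import structures.
From mathcomp Require Import all_boot all_order all_algebra.
From mathcomp Require Import boolp classical_sets functions cardinality.
From mathcomp Require Import interval_inference reals convex.

Set Implicit Arguments.
Unset Strict Implicit.
Unset Printing Implicit Defensive.

Import Order.TTheory GRing.Theory Num.Theory.
Local Open Scope ring_scope.
Local Open Scope quotient_scope.
Local Open Scope classical_set_scope.

(* Lattices are Z^n, with row vectors; N and its dual M are both written
   'rV[int]_n, N_R and M_R are 'rV[R]_n, and the pairing is the dot product. *)
Definition realmx (R : realType) m n (A : 'M[int]_(m, n)) : 'M[R]_(m, n) :=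
  map_mx intr A.

Section Cones.
Variables (R : realType) (n : nat).
Implicit Types (C F s : set 'rV[R]_n).

Definition pairing (m u : 'rV[R]_n) : R := (m *m u^T) 0 0.

Definition cone_gen p (G : 'M[R]_(p, n)) : set 'rV[R]_n :=
  [set x | exists2 a : 'rV[R]_p, (forall i, 0 <= a 0 i) & x = a *m G].

(* Dimension of the linear span: the largest size of a linearly independent
   family of elements. For a cone this is its dimension. *)
Definition span_dim (A : set 'rV[R]_n) : nat :=
  \max_(r < n.+1 | `[< exists B : 'M[R]_(r, n),
                        row_free B /\ forall i, A (row i B) >]) r.

(* Dimension of the affine hull: the dimension of its direction space. *)
Definition affdim (A : set 'rV[R]_n) : nat :=
  span_dim [set x - y | x in A & y in A].

Definition is_face F C : Prop :=
  [/\ F `<=` C, F 0,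
      forall x y, F x -> F y -> F (x + y),
      forall (a : R) x, 0 <= a -> F x -> F (a *: x) &
      forall x y, C x -> C y -> F (x + y) -> F x /\ F y].

Definition min_face F C (x : 'rV[R]_n) : Prop :=
  [/\ is_face F C, F x & forall F', is_face F' C -> F' x -> F `<=` F'].

End Cones.

Section Fans.
Variables (R : realType) (n : nat).
Implicit Types (Sigma : set (set 'rV[R]_n)) (s t F : set 'rV[R]_n).

Definition is_fan Sigma : Prop :=
  [/\ finite_set Sigma,
      Sigma !=set0,
      forall s, Sigma s ->
        (exists p (G : 'M[int]_(p, n)), s = cone_gen (realmx R G)) /\
        (forall x, s x -> s (- x) -> x = 0),
      forall s F, Sigma s -> is_face F s -> Sigma F &
      forall s t, Sigma s -> Sigma t ->
        is_face (s `&` t) s /\ is_face (s `&` t) t].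

Definition simplicial Sigma : Prop :=
  forall s, Sigma s -> exists p (G : 'M[int]_(p, n)),
    row_free (realmx R G) /\ s = cone_gen (realmx R G).

Definition fan_support Sigma : set 'rV[R]_n := \bigcup_(s in Sigma) s.

(* X_Sigma has a torus-fixed point iff Sigma has an n-dimensional cone. The map
   X_Sigma -> Spec Gamma(X_Sigma, O), whose target is the affine toric variety
   of the semigroup of m in M with m >= 0 on |Sigma|, is proper iff |Sigma| is
   convex, and is then projective iff there is a strictly convex integral
   support function on |Sigma|: m_s is the linear function which it restricts
   to on the full-dimensional cone s. *)
Definition semiprojective Sigma : Prop :=
  [/\ exists2 s, Sigma s & span_dim s = n,
      convex_set (fan_support Sigma : set (convex_lmodType 'rV[R]_n)) &
      exists m : set 'rV[R]_n -> 'rV[int]_n,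
        forall s t, Sigma s -> Sigma t -> span_dim s = n -> span_dim t = n ->
        forall u, t u ->
          pairing (realmx R (m t)) u <= pairing (realmx R (m s)) u /\
          (pairing (realmx R (m t)) u = pairing (realmx R (m s)) u <->
           s u)].

Definition fan_rays Sigma : set (set 'rV[R]_n) :=
  [set s | Sigma s /\ span_dim s = 1%N].

Definition primitive (w : 'rV[int]_n) : Prop :=
  forall (a : int) w', w = a *: w' -> a \is a GRing.unit.

(* The rows of v are the primitive generators of the rays, without repetition. *)
Definition ray_generators k Sigma (v : 'M[int]_(k, n)) : Prop :=
  [/\ forall j, primitive (row j v),
      injective (fun j => cone_gen (realmx R (row j v))) &
      range (fun j => cone_gen (realmx R (row j v))) = fan_rays Sigma].

End Fans.

Section IntegralCokernel.
Variables (p q : nat) (A : 'M[int]_(p, q)).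

Definition imZ : {pred 'rV[int]_q} := fun c => `[< exists m, c = m *m A >].

Fact imZ_zmod_closed : zmod_closed imZ.
Proof.
split; first by apply/asboolP; exists 0; rewrite mul0mx.
by move=> _ _ /asboolP[a ->] /asboolP[b ->]; apply/asboolP; exists (a - b);
  rewrite mulmxBl.
Qed.
HB.instance Definition _ := GRing.isZmodClosed.Build _ imZ imZ_zmod_closed.

Definition cokerZ : zmodType := Quotient.quot imZ.
End IntegralCokernel.

(* Everything in this section depends only on vectors v_1, ..., v_k in Z^n. *)
Section RayData.
Variables (R : realType) (n k : nat) (v : 'M[int]_(k, n)).

(* The matrix of phi : M_R -> R^k, acting on row vectors. *)
Definition phi : 'M[R]_(n, k) := (realmx R v)^T.

(* The cokernel of phi, realised as the row space of cokermx phi: the kernel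
   of x |-> x *m cokermx phi is exactly im(phi). *)
Definition clproj (x : 'rV[R]_k) : 'rV[R]_k := x *m cokermx phi.

Definition Eff : set 'rV[R]_k :=
  clproj @` [set x : 'rV[R]_k | forall j, 0 <= x 0 j].

Definition zonotope : set 'rV[R]_k :=
  clproj @` [set x : 'rV[R]_k | forall j, 0 <= x 0 j < 1].

Definition Cl : zmodType := cokerZ v^T.

Definition clR (d : Cl) : 'rV[R]_k := clproj (realmx R (repr d)).

Definition Theta : set Cl := [set th | zonotope (- clR th)].

(* The lattice phi^-1(Z^k) in M_R. *)
Definition latM : {pred 'rV[R]_n} :=
  fun u => [forall j, (u *m phi) 0 j \is a Num.int].

Fact latM_zmod_closed : zmod_closed latM.
Proof.
split; first by apply/forallP => j; rewrite mul0mx mxE rpred0.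
move=> x y /forallP xP /forallP yP; apply/forallP => j.
by rewrite mulmxBl mxE [X in _ + X]mxE rpredB.
Qed.
HB.instance Definition _ := GRing.isZmodClosed.Build _ latM latM_zmod_closed.

Definition torus : zmodType := Quotient.quot latM.

Definition int_in : {pred R} := fun x => x \is a Num.int.
Fact int_in_zmod_closed : zmod_closed int_in.
Proof. by split; [exact: rpred0 | exact: rpredB]. Qed.
HB.instance Definition _ := GRing.isZmodClosed.Build _ int_in int_in_zmod_closed.

Definition h (j : 'I_k) (t : torus) : Quotient.quot int_in :=
  \pi_(Quotient.quot int_in) ((repr t *m phi) 0 j).

Definition Phi (u : 'rV[R]_n) : 'rV[int]_k :=
  \row_j Num.ceil ((u *m phi) 0 j).

Definition fiber (c : 'rV[int]_k) : set 'rV[R]_n := [set u | Phi u = c].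

Definition stratum (c : 'rV[int]_k) : set torus := \pi_torus @` fiber c.

Definition is_stratum (S : set torus) : Prop :=
  exists2 c, fiber c !=set0 & S = stratum c.

(* S is a Phi-stratum, and the bijection from Phi-strata to the lattice points
   of the zonotope sends it to y. *)
Definition stratum_to (S : set torus) (y : 'rV[R]_k) : Prop :=
  is_stratum S /\
  exists u, S (\pi_torus u) /\ clproj (realmx R (Phi u)) = y.

Definition Jset (S : set torus) : {set 'I_k} :=
  [set j | `[< S `<=` h j @^-1` [set 0] >]]%SET.

(* The fibers of Phi with image S are translates of each other; one is chosen. *)
Definition stratum_dim (S : set torus) : nat :=
  affdim (fiber (xget 0 [set c | fiber c !=set0 /\ S = stratum c])).

End RayData.

Arguments Theta R {n k} v _.

(* The value of clR, and whether h_j vanishes, can be read off on any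
   representative. *)
Lemma clR_pi (R : realType) n k (v : 'M[int]_(k, n)) (c : 'rV[int]_k) :
  clR R (\pi_(Cl v) c) = clproj v (realmx R c).
Proof.
have /asboolP[m e] : repr (\pi_(Cl v) c) - c \in imZ v^T.
  by rewrite Quotient.idealrBE reprK.
apply/eqP; rewrite -subr_eq0 /clR /clproj -mulmxBl -map_mxB e map_mxM.
rewrite (_ : map_mx intr v^T = phi R v) -?mulmxA ?mulmx_coker ?mulmx0 //.
by apply/matrixP => i j; rewrite !mxE.
Qed.

Lemma h_pi_eq0 (R : realType) n k (v : 'M[int]_(k, n)) (j : 'I_k)
    (u : 'rV[R]_n) :
  h j (\pi_(torus R v) u) = 0 <-> (u *m phi R v) 0 j \is a Num.int.
Proof.
have /forallP/(_ j) : repr (\pi_(torus R v) u) - u \in @latM R n k v.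
  by rewrite Quotient.idealrBE reprK.
rewrite mulmxBl mxE [X in _ + X]mxE => du.
have hE : h j (\pi_(torus R v) u) =
    \pi_(Quotient.quot (@int_in R)) ((u *m phi R v) 0 j).
  by apply/eqP; rewrite -Quotient.idealrBE.
have -> : (0 : Quotient.quot (@int_in R)) =
    \pi_(Quotient.quot (@int_in R)) 0 by rewrite piE.
rewrite hE; split => [/eqP|ui].
  by rewrite -Quotient.idealrBE subr0.
by apply/eqP; rewrite -Quotient.idealrBE subr0.
Qed.

(* Toric data over a finitely generated abelian group
     N' = Z^r + (Z/a_1 + ... + Z/a_s),  with all a_i > 1:
   a fan in N'_R = R^r together with k elements beta_j = (b_j, t_j mod a) of N',
   given by the rows of ts_b and ts_t, whose nonzero images b_j generate exactly
   the rays of the fan. The case s = 0, with the b_j the primitive generators of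
   distinct rays, is that of an r-dimensional toric variety. In general this is
   an extended stacky fan; the associated toric stack has dimension r. This is
   the generality needed for quotients of N by the span of some of the v_j: these
   can have torsion, and the other v_j can become torsion, imprimitive or
   proportional in them. *)
Record toric_stack (R : realType) (r k : nat) := ToricStack {
  ts_s : nat;
  ts_a : 'rV[int]_ts_s;
  ts_b : 'M[int]_(k, r);
  ts_t : 'M[int]_(k, ts_s);
  ts_fan : set (set 'rV[R]_r);
  ts_a_gt1 : forall i, 1 < ts_a 0 i;
  ts_fanP : is_fan ts_fan;
  ts_fan_rays : fan_rays ts_fan =
    [set cone_gen (realmx R (row j ts_b)) | j in [set j | row j ts_b != 0]]
}.

Section StackClassGroup.
Variables (R : realType) (r k : nat) (X : toric_stack R r k).

(* The Gale dual of beta : Z^k -> N' (the class group). With the free resolution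
   0 -> Z^s -> Z^(r+s) -> N' -> 0 it is the quotient of Z^k + Z^s by the vectors
   ((<m,b_j> + <e,t_j>)_j, (a_i e_i)_i), for (m, e) in Z^r + Z^s. For s = 0 it is
   Z^k / phi(Z^r). *)
Definition ts_Cl : zmodType :=
  cokerZ (block_mx (ts_b X)^T 0 (ts_t X)^T (diag_mx (ts_a X))).

(* The map to Cl (x) R = R^k / phi(M'_R), where M'_R = R^r: in R^k + R^s modulo
   the above relations, (c, z) equals (c - (<e,t_j>)_j, 0) for e_i = z_i / a_i. *)
Definition ts_clR (th : ts_Cl) : 'rV[R]_k :=
  let c := lsubmx (repr th) in
  let e : 'rV[R]_(ts_s X) :=
    \row_i ((rsubmx (repr th) 0 i)%:~R / (ts_a X 0 i)%:~R) in
  clproj (ts_b X) (realmx R c - e *m (realmx R (ts_t X))^T).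

Definition ts_Theta : set ts_Cl := [set th | zonotope (ts_b X) (- ts_clR th)].

End StackClassGroup.

Arguments ts_Theta {R r k} X _.

(* Over a torsion-free group, ts_Cl and ts_Theta are, up to isomorphism, the Cl
   and Theta of the vectors b_j. *)
Lemma ts_Cl_free (R : realType) (r k : nat) (X : toric_stack R r k) :
  ts_s X = 0%N ->
  exists f : ts_Cl X -> Cl (ts_b X),
    [/\ bijective f, {morph f : x y / x - y} &
        forall th, clR R (f th) = ts_clR th].
Proof.
case: X => s a b t F a1 FP FR /= s0; subst s.
set X := ToricStack t a1 FP FR.
have relE (w : 'rV[int]_(k + 0)) :
    (w \in imZ (block_mx b^T 0 t^T (diag_mx a))) = (lsubmx w \in imZ b^T).
  apply/asboolP/asboolP => [[m ->]|[m e]].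
    exists (lsubmx m); rewrite -[m in LHS]hsubmxK mul_row_block row_mxKl.
    by rewrite [rsubmx m]thinmx0 mul0mx addr0.
  exists (row_mx m 0); rewrite mul_row_block !mul0mx !addr0 mulmx0 -e.
  by rewrite -[LHS]hsubmxK; congr row_mx; apply/matrixP => i [].
exists (fun th => \pi_(Cl b) (lsubmx (repr th))); split; last first.
- move=> th; rewrite clR_pi /ts_clR /=; congr clproj.
  rewrite [X in _ - X](_ : _ = 0) ?subr0 //.
  by apply/matrixP => i j; rewrite !mxE big_ord0.
- move=> x y /=; rewrite -raddfB -linearB /=; apply/eqP.
  rewrite -Quotient.idealrBE -linearB -relE Quotient.idealrBE reprK.
  by rewrite raddfB /= !reprK.
exists (fun d : Cl b => \pi_(ts_Cl X) (row_mx (repr d) 0)) => [th|d].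
  rewrite -[RHS]reprK; apply/eqP; rewrite -Quotient.idealrBE relE.
  by rewrite linearB /= row_mxKl Quotient.idealrBE reprK.
rewrite -[RHS]reprK; apply/eqP; rewrite -Quotient.idealrBE.
rewrite -[X in _ - X](row_mxKl _ (0 : 'M[int]_(1, 0))) -linearB -relE.
by rewrite Quotient.idealrBE reprK.
Qed.

Section QuotientData.
Variables (R : realType) (n k : nat) (v : 'M[int]_(k, n)) (J : {set 'I_k}).

Definition rows_off : 'M[int]_(#|~: J|, n) :=
  rowsub (fun i : 'I_#|~: J| => enum_val i) v.

Definition extend0 (x : 'rV[R]_#|~: J|) : 'rV[R]_k :=
  \sum_(i < #|~: J|) x 0 i *: delta_mx 0 (enum_val i).

(* The map x |-> (x *m q, x *m p mod a) from N = Z^n to N' is a surjection with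
   kernel span_Z(v_j : j in J), hence an isomorphism from N / span_Z(v_j : j in J)
   to N', and it sends the v_j with j not in J to the beta's of X. *)
Definition is_quotient_stack r (X : toric_stack R r #|~: J|) : Prop :=
  exists (q : 'M[int]_(n, r)) (p : 'M[int]_(n, ts_s X)),
    [/\ forall (y : 'rV[int]_r) (z : 'rV[int]_(ts_s X)),
          exists (x : 'rV[int]_n) (w : 'rV[int]_(ts_s X)),
          x *m q = y /\ x *m p = z + w *m diag_mx (ts_a X),
        forall x : 'rV[int]_n,
          (x *m q = 0 /\ exists w, x *m p = w *m diag_mx (ts_a X)) <->
          (exists2 c : 'rV[int]_k,
             (forall j, j \notin J -> c 0 j = 0) & x = c *m v),
        ts_b X = rows_off *m q &
        ts_t X = rows_off *m p].

(* The linear map coker(phi') -> coker(phi) induced by extension by zero exists,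
   is injective, and maps Eff(X') onto tau. When X' is the quotient datum above,
   R^r is identified through q with the u in M_R orthogonal to all v_j, j in J,
   and phi' pairs such a u with the v_j, j not in J. *)
Definition Eff_identified r (X : toric_stack R r #|~: J|) (tau : set 'rV[R]_k)
    : Prop :=
  exists iota : 'M[R]_(#|~: J|, k),
    [/\ forall x, clproj (ts_b X) x *m iota = clproj v (extend0 x),
        forall x, clproj (ts_b X) x *m iota = 0 -> clproj (ts_b X) x = 0 &
        [set y *m iota | y in Eff (ts_b X)] = tau].

End QuotientData.

(* Main.v *)
Require Import Defs.
From HB Require Import structures.
From mathcomp Require Import all_boot all_order all_algebra.
From mathcomp Require Import lra.
From mathcomp Require Import boolp classical_sets functions cardinality.
From mathcomp Require Import interval_inference reals convex.
Import Order.TTheory GRing.Theory Num.Theory.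
Local Open Scope ring_scope.
Local Open Scope classical_set_scope.

(** Let S be the image of the fiber of Phi over c, and let J be its tight set.
    For u in this fiber, c - phi(u) lies in [0,1)^k and represents the class of d.
    By convexity some u makes all coordinates off J positive, while those in J
    vanish for every u (fiber_interior). Moving u a little gives the fact on which
    everything rests (tight_recession): if w pairs nonnegatively with v_j for all
    j in J, then it pairs to zero with all of them. Hence

    - the fiber is, near an interior point, a translate of the space W orthogonal
      to the v_j with j in J, so dim S = dim W (affdim_fiber);
    - the minimal face tau is the image of the nonnegative orthant of the
      coordinates off J (min_faceE);
    - the classes in the zonotope that are represented in the cube by a vector
      supported off J are those whose stratum has a tight set containing J
      (face_strata).

    The v_j span N_R, because Sigma has a full-dimensional simplicial cone
    (ray_generators_full). So phi is injective, the kernel of the projection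
    restricted to the coordinates off J is phi(W), and rank-nullity gives
    dim tau + dim W = k - |J| (rank_clproj_incl).

    For the second part, the Smith normal form splits N' = N / span(v_j : j in J)
    as a free group of rank dim W plus a torsion group (quotient_splitting). The
    toric datum has the fan formed by the origin and the rays through the nonzero
    images of the v_j. Linear forms on the free part of N' are the elements of W,
    so extension by zero induces an injection of real class groups whose image of
    the effective cone is tau (Eff_quotient_stack). It lifts to a homomorphism of
    integral class groups (cl_map), Gale dual to N -> N'. This is injective, and it
    reaches every class with a real representative supported off J, because a real
    form that is integral on span(v_j : j in J) is, up to an integral form and an
    element of W, a torsion form of N' (cl_map_ker, cl_map_surj). Comparing
    zonotopes through the injection gives the bijection of Bondal-Thomsen
    collections. *)

Set Implicit Arguments.
Unset Strict Implicit.
Unset Printing Implicit Defensive.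

(* The name realmx also denotes a predicate on matrices in the algebra library. *)
Local Notation realmx := Defs.realmx.

(** * Extension of scalars to the reals *)

Section RealScalars.
Variable R : realType.

Lemma realmxM l m h (B : 'M[int]_(l, m)) (C : 'M[int]_(m, h)) :
  realmx R (B *m C) = realmx R B *m realmx R C.
Proof. exact: map_mxM. Qed.

Lemma realmxD l m (B C : 'M[int]_(l, m)) :
  realmx R (B + C) = realmx R B + realmx R C.
Proof. exact: map_mxD. Qed.

Lemma realmx0 l m : realmx R (0 : 'M[int]_(l, m)) = 0.
Proof. exact: map_mx0. Qed.

Lemma realmx1 l : realmx R (1%:M : 'M[int]_l) = 1%:M.
Proof. exact: map_mx1. Qed.

Lemma realmx_tr l m (B : 'M[int]_(l, m)) : (realmx R B)^T = realmx R B^T.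
Proof. exact: map_trmx. Qed.

Lemma realmx_inj l m : injective (@Defs.realmx R l m).
Proof.
move=> B C /matrixP BC; apply/matrixP => i j.
by have := BC i j; rewrite mxE [RHS]mxE => /intr_inj.
Qed.

Lemma phiE l m (b : 'M[int]_(l, m)) : phi R b = realmx R b^T.
Proof. by rewrite /phi /Defs.realmx map_trmx. Qed.

End RealScalars.

(** * Coordinate subspaces *)
Section Inclusion.
Variables (F : nzRingType) (k : nat).
Implicit Types (A B : {set 'I_k}).

(** Extension by zero R^A -> R^k, acting on row vectors; the transpose is the
    restriction R^k -> R^A. *)
Definition inclmx A : 'M[F]_(#|A|, k) :=
  rowsub (fun i : 'I_#|A| => enum_val i) 1%:M.

Lemma mul_incl_tr A m (M : 'M[F]_(m, k)) i l :
  (M *m (inclmx A)^T) i l = M i (enum_val l).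
Proof.
rewrite mxE (bigD1 (enum_val l)) //= big1 ?addr0.
  by rewrite !mxE eqxx mulr1.
by move=> j /negPf nj; rewrite !mxE eq_sym nj mulr0.
Qed.

Lemma mul_incl_val A m (M : 'M[F]_(m, #|A|)) i l :
  (M *m inclmx A) i (enum_val l) = M i l.
Proof.
rewrite mxE (bigD1 l) //= big1 ?addr0.
  by rewrite !mxE eqxx mulr1.
by move=> j nj; rewrite !mxE (inj_eq enum_val_inj) (negPf nj) mulr0.
Qed.

Lemma mul_incl_out A m (M : 'M[F]_(m, #|A|)) i j :
  j \notin A -> (M *m inclmx A) i j = 0.
Proof.
move=> jA; rewrite mxE big1 // => l _; rewrite !mxE.
case: eqP => [ej|]; last by rewrite mulr0.
by rewrite -ej enum_valP in jA.
Qed.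

Lemma mem_enum_val A j : j \in A -> exists i : 'I_#|A|, j = enum_val i.
Proof. by move=> jA; exists (enum_rank_in jA j); rewrite enum_rankK_in. Qed.

Lemma incl_inclT A : inclmx A *m (inclmx A)^T = 1%:M.
Proof.
by apply/matrixP => i l; rewrite mul_incl_tr -[inclmx A]mul1mx mul_incl_val.
Qed.

Lemma incl_inclT0 A B : (forall j, j \in A -> j \notin B) ->
  inclmx A *m (inclmx B)^T = 0.
Proof.
move=> dAB; apply/matrixP => i l; rewrite mul_incl_tr -[inclmx A]mul1mx.
by rewrite mul_incl_out ?mxE //; apply: contraL (enum_valP l) => /dAB.
Qed.

Lemma mul_inclT_incl A m (M : 'M[F]_(m, k)) i j :
  (M *m (inclmx A)^T *m inclmx A) i j = if j \in A then M i j else 0.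
Proof.
case: ifP => [jA|/negbT jA]; last exact: mul_incl_out.
by have [l ->] := mem_enum_val jA; rewrite mul_incl_val mul_incl_tr.
Qed.

Lemma incl_decomp A :
  (inclmx A)^T *m inclmx A + (inclmx (~: A))^T *m inclmx (~: A) = 1%:M.
Proof.
rewrite -[X in X *m inclmx A]mul1mx -[X in X *m inclmx (~: A)]mul1mx.
apply/matrixP => i j; rewrite mxE !mul_inclT_incl inE.
by case: (j \in A); rewrite ?addr0 ?add0r.
Qed.

Lemma incl_support A m (M : 'M[F]_(m, k)) :
  (forall i j, j \notin A -> M i j = 0) -> M *m (inclmx A)^T *m inclmx A = M.
Proof.
move=> M0; apply/matrixP => i j; rewrite mul_inclT_incl.
by case: ifP => // /negbT/M0 ->.
Qed.

End Inclusion.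

Arguments inclmx {F k} A.

Lemma map_incl (R : realType) k (A : {set 'I_k}) :
  realmx R (inclmx A) = inclmx A.
Proof. by apply/matrixP => i j; rewrite !mxE; case: eqP. Qed.

(** * Splitting the quotient of a lattice by a sublattice *)

(** An isomorphism of Z^n / N_A with Z^r + (Z/a_1 + ... + Z/a_s), where N_A is
    the row span of A. The quotient map is x |-> (x q, x p mod a); the rows of
    Xq and Xp lift the generators of the two summands; C, D and W write as
    combinations of the rows of A, or of the moduli, the vectors that vanish in
    the quotient. Matrix identities are used, rather than statements about
    integer vectors, because they survive transposition and extension of scalars:
    applied to elements of M_R they decompose real linear forms on Z^n, which is
    how the splitting is used throughout. *)
Record quotient_splitting m n (A : 'M[int]_(m, n)) := QuotientSplitting {
  qs_r : nat;
  qs_s : nat;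
  qs_a : 'rV[int]_qs_s;
  qs_q : 'M[int]_(n, qs_r);
  qs_p : 'M[int]_(n, qs_s);
  qs_Xq : 'M[int]_(qs_r, n);
  qs_Xp : 'M[int]_(qs_s, n);
  qs_C : 'M[int]_(n, m);
  qs_D : 'M[int]_(qs_s, m);
  qs_W : 'M[int]_(m, qs_s);
  qs_a_gt1 : forall i, 1 < qs_a 0 i;
  qs_Aq : A *m qs_q = 0;
  qs_Ap : A *m qs_p = qs_W *m diag_mx qs_a;
  qs_aX : diag_mx qs_a *m qs_Xp = qs_D *m A;
  qs_1 : qs_q *m qs_Xq + qs_p *m qs_Xp + qs_C *m A = 1%:M;
  qs_Xqq : qs_Xq *m qs_q = 1%:M;
  qs_Xqp : qs_Xq *m qs_p = 0;
  qs_Xpq : qs_Xp *m qs_q = 0;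
  qs_Xpp : qs_Xp *m qs_p = 1%:M }.

(** In a basis adapted to the Smith normal form the row span of A is a product of
    subgroups g_j Z of Z. With g_j = 0 for the columns beyond the number of rows,
    the criterion is uniform in j. *)
Lemma row_span_Smith m n (A : 'M[int]_(m, n)) :
  exists (B : 'M[int]_n) (g : 'I_n -> int), B \in unitmx /\
    forall l (M : 'M[int]_(l, n)),
      (exists C, M = C *m A) <-> forall i j, (g j %| (M *m B) i j)%Z.
Proof.
have [L Lu [T Tu [d _ dA]]] := int_Smith_normal_form A.
set Dg := (\matrix_(i, j) _) in dA.
pose g (j : 'I_n) := if (j < m)%N then d`_j else 0.
have DgE l (Y : 'M[int]_(l, m)) i (j : 'I_n) : (Y *m Dg) i j =
    (if insub (val j) is Some j' then Y i j' else 0) * g j.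
  rewrite mxE /g; case: insubP => [j' -> j'j|/negPf jm].
    rewrite (bigD1 j') //= big1 ?addr0.
      by rewrite mxE j'j eqxx mulr1n.
    move=> h; rewrite mxE -val_eqE /= -j'j => /negPf ->.
    by rewrite mulr0n mulr0.
  rewrite jm mulr0 big1 // => h _; rewrite mxE.
  case: eqP => [hj|]; last by rewrite mulr0n mulr0.
  by have := ltn_ord h; rewrite hj jm.
exists (invmx T), g; split=> [|l M]; first by rewrite unitmx_inv.
split=> [[C ->] i j|gM].
  by rewrite dA !mulmxA mulmxK // DgE dvdz_mull.
pose Y : 'M[int]_(l, m) := \matrix_(i, j)
  (if insub (val j) is Some j' then ((M *m invmx T) i j' %/ g j')%Z else 0).
exists (Y *m invmx L); rewrite dA !mulmxA mulmxKV //.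
suff -> : Y *m Dg = M *m invmx T by rewrite mulmxKV.
apply/matrixP => i j; rewrite DgE.
have := gM i j; case: insubP => [j' jm j'j|/negPf jm].
  by rewrite [Y _ _]mxE j'j valK; exact: divzK.
by rewrite /g jm mul0r dvd0z => /eqP ->.
Qed.

(** In the adapted basis the coordinates with g_j = 0 span the free part, those
    with |g_j| > 1 the torsion part, and those with |g_j| = 1 die in the
    quotient. *)
Lemma quotient_splitting_exists m n (A : 'M[int]_(m, n)) :
  inhabited (quotient_splitting A).
Proof.
have [B [g [Bu spanA]]] := row_span_Smith A.
pose Z := [set i | absz (g i) == 0%N]%SET.
pose U := [set i | absz (g i) == 1%N]%SET.
pose T := [set i | (1 < absz (g i))%N]%SET.
pose EZ : 'M[int]_(_, n) := inclmx Z.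
pose ET : 'M[int]_(_, n) := inclmx T.
pose EU : 'M[int]_(_, n) := inclmx U.
pose a : 'rV[int]_#|T| := \row_i Posz (absz (g (enum_val i))).
have dvA i j : (g j %| (A *m B) i j)%Z 
  by apply: (spanA _ A).1; exists 1%:M; rewrite mul1mx.
have [|C CA] := (spanA _ (B *m EU^T *m EU *m invmx B)).2.
  move=> i j; rewrite mulmxKV // mul_inclT_incl; case: ifP; rewrite ?dvdz0 //.
  by rewrite inE dvdzE => /eqP ->; rewrite dvd1n.
have [|D DA] := (spanA _ (diag_mx a *m ET *m invmx B)).2.
  move=> i j; rewrite mulmxKV //.
  have [jT|jT] := boolP (j \in T); last by rewrite mul_incl_out ?dvdz0.
  have [l ->] := mem_enum_val jT; rewrite mul_incl_val !mxE dvdzE.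
  by case: eqP => [->|_]; rewrite ?mulr0n ?mulr1n ?dvdn0 /= ?dvdnn.
pose W : 'M[int]_(m, #|T|) :=
  \matrix_(i, j) divz ((A *m B *m ET^T) i j) (a 0 j).
apply: (inhabits (@QuotientSplitting _ _ _ _ _ a (B *m EZ^T) (B *m ET^T)
  (EZ *m invmx B) (ET *m invmx B) C D W _ _ _ _ _ _ _ _ _)).
- by move=> i; rewrite mxE; have := enum_valP i; rewrite inE.
- apply/matrixP => i j; rewrite mulmxA mul_incl_tr [RHS]mxE.
  by have := dvA i (enum_val j); have := enum_valP j; rewrite inE dvdzE => /eqP ->;
    rewrite dvd0n absz_eq0 => /eqP.
- apply/matrixP => i j; rewrite mulmxA mul_mx_diag [RHS]mxE [W _ _]mxE mul_incl_tr.
  by rewrite divzK // [a 0 j]mxE; have := dvA i (enum_val j); rewrite !dvdzE.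
- by rewrite mulmxA.
- rewrite -CA !mulmxA -!mulmxDl.
  rewrite -[X in _ = X](mulmxV Bu) -[X in _ = X *m _]mulmx1; congr (_ *m _).
  rewrite -!mulmxA -!mulmxDr; congr (_ *m _).
  rewrite -[EZ^T]mul1mx -[ET^T]mul1mx -[EU^T]mul1mx.
  apply/matrixP => i j; rewrite mxE [X in X + _]mxE !mul_inclT_incl !inE.
  by case: (absz (g j)) => [|[|w]]; rewrite ?addr0 ?add0r.
- by rewrite !mulmxA mulmxKV // incl_inclT.
- rewrite !mulmxA mulmxKV // incl_inclT0 // => j; rewrite !inE.
  by move/eqP->.
- rewrite !mulmxA mulmxKV // incl_inclT0 // => j; rewrite !inE.
  by case: (absz (g j)).
- by rewrite !mulmxA mulmxKV // incl_inclT.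
Qed.

(** * Dimension of the span *)
Section SpanDim.
Variables (R : realType) (n : nat).
Implicit Types (A : set 'rV[R]_n).

Lemma span_dim_free A :
  exists B : 'M[R]_(span_dim A, n), row_free B /\ forall i, A (row i B).
Proof.
pose P (r : 'I_n.+1) :=
  `[< exists B : 'M[R]_(r, n), row_free B /\ forall i, A (row i B) >].
have -> : span_dim A = \max_(r in P) r by [].
have [|r /asboolP rP ->] := @eq_bigmax_cond _ P (@nat_of_ord _); last exact: rP.
apply/card_gt0P; exists ord0; apply/asboolP; exists 0.
by split=> [|[]//]; rewrite /row_free mxrank0.
Qed.

Lemma span_dim_max A r (B : 'M[R]_(r, n)) :
  row_free B -> (forall i, A (row i B)) -> (r <= span_dim A)%N.
Proof.
move=> Bf AB.
have rn : (r < n.+1)%N by rewrite ltnS -(eqP Bf) rank_leq_col.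
apply: (@leq_bigmax_cond _ _ (fun r : 'I_n.+1 => nat_of_ord r) (Ordinal rn)).
by apply/asboolP; exists B.
Qed.

(** The rows of M may be dependent, and only nonzero multiples of them need to lie
    in A: the generators of a face of the effective cone are dependent, and the
    differences of points of a fiber of Phi are short vectors. *)
Lemma span_dimE A p (M : 'M[R]_(p, n)) :
  (forall x, A x -> (x <= M)%MS) ->
  (forall i, exists2 e : R, e != 0 & A (e *: row i M)) ->
  span_dim A = \rank M.
Proof.
move=> AM MA; apply/eqP; rewrite eqn_leq; apply/andP; split.
  have [B [/eqP Bf AB]] := span_dim_free A.
  by rewrite -[X in (X <= _)%N]Bf mxrankS //; apply/row_subP => i; apply/AM/AB.
have [e eP] := boolp.choice (fun i => (let: ex_intro2 e e0 eA := MA i in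
  ex_intro (fun e => e != 0 /\ A (e *: row i M)) e (conj e0 eA))).
pose N := rowsub (maxrankfun M) M.
pose E := \row_i e (maxrankfun M i).
apply: (@span_dim_max _ _ (diag_mx E *m N)).
  rewrite /row_free mxrankMfree ?maxrowsub_free //.
  suff : diag_mx E \in unitmx by rewrite -row_free_unit.
  rewrite unitmxE det_diag unitfE; apply/prodf_neq0 => i _.
  by rewrite mxE; case: (eP (maxrankfun M i)).
move=> i; have -> : row i (diag_mx E *m N) =
    e (maxrankfun M i) *: row (maxrankfun M i) M.
  by apply/rowP => j; rewrite mul_diag_mx !mxE.
by case: (eP (maxrankfun M i)).
Qed.

End SpanDim.

(** * Rays of fans *)
Section RaysOfFans.
Variables (R : realType) (n : nat).
Implicit Types (Sigma : set (set 'rV[R]_n)).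

Lemma cone_gen_row p (G : 'M[R]_(p, n)) i : cone_gen G (row i G).
Proof.
exists (delta_mx 0 i); last by rewrite -rowE.
by move=> j; rewrite mxE; case: eqP; case: eqP; rewrite ?ler01 ?lexx.
Qed.

Lemma cone_gen_sub p (G : 'M[R]_(p, n)) x : cone_gen G x -> (x <= G)%MS.
Proof. by case=> a _ ->; apply: submxMl. Qed.

Lemma cone_gen1P (g x : 'rV[R]_n) :
  cone_gen g x <-> exists2 a : R, 0 <= a & x = a *: g.
Proof.
split=> [[a a0 ->]|[a a0 ->]].
  by exists (a 0 0); rewrite // {1}[a]mx11_scalar mul_scalar_mx.
by exists a%:M => [i|]; rewrite ?mul_scalar_mx // !ord1 mxE eqxx mulr1n.
Qed.

Lemma span_dim_ray (g : 'rV[R]_n) : g != 0 -> span_dim (cone_gen g) = 1%N.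
Proof.
move=> g0; rewrite (@span_dimE _ _ _ _ g) ?rank_rV ?g0 //.
  exact: cone_gen_sub.
move=> i; exists 1; rewrite ?oner_neq0 // scale1r; exact: cone_gen_row.
Qed.

(** Coefficients over a linearly independent family are unique, so a sum of two
    points of the cone lies on an edge only if all other coefficients vanish in
    both. *)
Lemma simplex_edge_face p (G : 'M[R]_(p, n)) i :
  row_free G -> is_face (cone_gen (row i G)) (cone_gen G).
Proof.
move=> Gf; split.
- move=> x /cone_gen1P[a a0 ->]; exists (a *: delta_mx 0 i); last first.
    by rewrite -scalemxAl -rowE.
  by move=> j; rewrite !mxE mulr_ge0 // ler0n.
- by apply/cone_gen1P; exists 0; rewrite ?scale0r.
- move=> x y /cone_gen1P[a a0 ->] /cone_gen1P[b b0 ->].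
  by apply/cone_gen1P; exists (a + b); rewrite ?addr_ge0 // scalerDl.
- move=> c x c0 /cone_gen1P[a a0 ->].
  by apply/cone_gen1P; exists (c * a); rewrite ?mulr_ge0 // scalerA.
move=> x y [a a0 ->] [b b0 ->] /cone_gen1P[c c0 abc].
have abE : a + b = c *: delta_mx 0 i.
  by apply: (row_free_inj Gf); rewrite mulmxDl abc -scalemxAl -rowE.
have ab0 j : j != i -> a 0 j = 0 /\ b 0 j = 0.
  move=> ji; have /rowP/(_ j) := abE; rewrite !mxE (negPf ji) andbF mulr0.
  by move/eqP; rewrite paddr_eq0 // => /andP[/eqP -> /eqP ->].
by split; apply/cone_gen1P; [exists (a 0 i)|exists (b 0 i)] => //;
  rewrite rowE scalemxAl; congr (_ *m _); apply/rowP => j; rewrite !mxE eqxx;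
  case: eqP => [->|/eqP/ab0[]]; rewrite ?mulr1 ?mulr0.
Qed.

(** The n-dimensional cone that expresses the existence of a torus-fixed point is
    simplicial, hence spanned by its edges; these are faces, so they belong to the
    fan and are rays. *)
Lemma ray_generators_full k Sigma (v : 'M[int]_(k, n)) :
  is_fan Sigma -> simplicial Sigma -> semiprojective Sigma ->
  ray_generators Sigma v -> row_full (realmx R v).
Proof.
move=> [_ _ _ faceS _] simpS [[s Ss sn] _ _] [_ _ raysv].
have [p [G [Gf sG]]] := simpS s Ss.
have Gfull : row_full (realmx R G).
  rewrite /row_full eqn_leq rank_leq_col /= -[X in (X <= _)%N]sn.
  have [B [/eqP Bf sB]] := span_dim_free s.
  rewrite -[X in (X <= _)%N]Bf mxrankS //.
  by apply/row_subP => i; apply: cone_gen_sub; rewrite -sG.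
rewrite /row_full eqn_leq rank_leq_col /= -{1}(eqP Gfull) mxrankS //.
apply/row_subP => i.
have : fan_rays Sigma (cone_gen (row i (realmx R G))).
  split; first by apply: (faceS s) => //; rewrite sG; exact: simplex_edge_face.
  apply/span_dim_ray/eqP => Gi0.
  have /rowP/(_ i) : delta_mx 0 i = 0 :> 'rV[R]_p.
    by apply: (row_free_inj Gf); rewrite mul0mx -rowE.
  by rewrite !mxE !eqxx => /eqP; rewrite oner_eq0.
rewrite -raysv => -[j _ vG].
have : cone_gen (realmx R (row j v)) (row i (realmx R G)).
  by rewrite vG; apply/cone_gen1P; exists 1; rewrite ?scale1r.
move/cone_gen_sub/submx_trans; apply.
by rewrite /Defs.realmx map_row row_sub.
Qed.

Lemma cone_gen0 : cone_gen (0 : 'rV[R]_n) = [set 0].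
Proof.
apply/seteqP; split=> x /=; first by case/cone_gen1P => a _ ->; rewrite scaler0.
by move=> ->; apply/cone_gen1P; exists 0; rewrite ?scale0r.
Qed.

Lemma cone_gen1_pointed (g x : 'rV[R]_n) :
  cone_gen g x -> cone_gen g (- x) -> x = 0.
Proof.
move=> /cone_gen1P[a a0 ->] /cone_gen1P[b b0 /eqP].
rewrite -scaleNr -subr_eq0 -scalerBl scaler_eq0 => /orP[|/eqP->]; last first.
  by rewrite scaler0.
by rewrite -opprD oppr_eq0 paddr_eq0 // => /andP[/eqP -> _]; rewrite scale0r.
Qed.

Lemma face_cone_gen1 (g : 'rV[R]_n) F : is_face F (cone_gen g) <->
  F = [set 0] \/ F = cone_gen g.
Proof.
split=> [[FC F0 FD FZ FE]|[->|->]].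
- have [Fg|nFg] := pselect (F g); [right|left]; apply/seteqP; split=> // x.
  + by move=> /cone_gen1P[a a0 ->]; apply: FZ.
  + move=> Fx /=; have /cone_gen1P[a a0 xE] := FC _ Fx.
    have [a_eq0|a_neq0] := eqVneq a 0; first by rewrite xE a_eq0 scale0r.
    by case: nFg; rewrite -[g](scalerK a_neq0) -xE; apply: FZ; rewrite ?invr_ge0.
  + by move=> /= ->.
- split=> [_ /= ->|//|x y /= -> ->|a x _ /= ->|x y Cx Cy /= xy0].
  + by apply/cone_gen1P; exists 0; rewrite ?scale0r.
  + by rewrite addr0.
  + by rewrite scaler0.
  + have /eqP := xy0; rewrite addr_eq0 => /eqP xy.
    have x0 : x = 0.
      by apply: (cone_gen1_pointed Cx); rewrite xy opprK.
    by split=> //; move: xy0; rewrite x0 add0r.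
- split=> //.
  + by apply/cone_gen1P; exists 0; rewrite ?scale0r.
  + move=> x y /cone_gen1P[a a0 ->] /cone_gen1P[b b0 ->].
    by apply/cone_gen1P; exists (a + b); rewrite ?addr_ge0 // scalerDl.
  + move=> c x c0 /cone_gen1P[a a0 ->].
    by apply/cone_gen1P; exists (c * a); rewrite ?mulr_ge0 // scalerA.
Qed.

Lemma cone_gen1_meet (g g' : 'rV[R]_n) :
  cone_gen g `&` cone_gen g' = [set 0] \/ cone_gen g = cone_gen g'.
Proof.
have sub (h h' : 'rV[R]_n) c : 0 < c -> h = c *: h' ->
    cone_gen h `<=` cone_gen h'.
  move=> c0 -> x /cone_gen1P[a a0 ->]; apply/cone_gen1P; exists (a * c).
    by rewrite mulr_ge0 // ltW.
  by rewrite scalerA.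
have [[x [/cone_gen1P[a a0 xa] /cone_gen1P[b b0 xb] x0]]|nx] := pselect
    (exists x, [/\ cone_gen g x, cone_gen g' x & x <> 0]); last first.
  left; apply/seteqP; split=> [x [xg xg']|x /= ->].
    by have [//|x0] := pselect (x = 0); case: nx; exists x.
  by split; apply/cone_gen1P; exists 0; rewrite ?scale0r.
have pos (c : R) h : 0 <= c -> x = c *: h -> 0 < c.
  rewrite le_eqVlt => /orP[/eqP <-|//] xE.
  by case: x0; rewrite xE scale0r.
have {a0}a0 := pos a g a0 xa; have {b0}b0 := pos b g' b0 xb.
right; apply/seteqP; split.
  apply: (@sub _ _ (a^-1 * b)); first by rewrite mulr_gt0 ?invr_gt0.
  by rewrite -scalerA -xb xa scalerK // gt_eqF.
apply: (@sub _ _ (b^-1 * a)); first by rewrite mulr_gt0 ?invr_gt0.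
by rewrite -scalerA -xa xb scalerK // gt_eqF.
Qed.

(** The smallest fan with prescribed rays: two distinct rays meet in the origin
    only, so no other compatibility has to be arranged. *)
Definition ray_fan p (b : 'M[int]_(p, n)) : set (set 'rV[R]_n) :=
  [set [set 0]] `|`
  [set cone_gen (realmx R (row j b)) | j in [set j | row j b != 0]].

Lemma realmx_eq0 m p (A : 'M[int]_(m, p)) : (realmx R A == 0) = (A == 0).
Proof.
apply/eqP/eqP => [/matrixP A0|->]; last by apply/matrixP => i j; rewrite !mxE.
by apply/matrixP => i j; have := A0 i j; rewrite !mxE => /eqP;
  rewrite intr_eq0 => /eqP.
Qed.

Lemma ray_fanP p (b : 'M[int]_(p, n)) s : ray_fan b s ->
  exists g : 'rV[int]_n, s = cone_gen (realmx R g).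
Proof.
case=> [->|[j _ <-]]; last by eexists.
exists 0; rewrite -cone_gen0; congr cone_gen.
by apply/eqP; rewrite eq_sym realmx_eq0.
Qed.

Lemma ray_fan_is_fan p (b : 'M[int]_(p, n)) : is_fan (ray_fan b).
Proof.
split.
- rewrite finite_setU; split; first exact: finite_set1.
  apply: finite_image; exact: finite_finset.
- by exists [set 0]; left.
- move=> s /ray_fanP[g ->]; split; first by exists 1%N, g.
  exact: cone_gen1_pointed.
- move=> s F sb; have [g sg] := ray_fanP sb.
  by rewrite sg face_cone_gen1 -sg => -[->|->] //; left.
move=> s t /ray_fanP[g ->] /ray_fanP[g' ->].
rewrite !face_cone_gen1; have [->|->] := cone_gen1_meet (realmx R g) (realmx R g').
  by split; left.
by rewrite setIid; split; right.
Qed.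

Lemma ray_fan_rays p (b : 'M[int]_(p, n)) : fan_rays (ray_fan b) =
  [set cone_gen (realmx R (row j b)) | j in [set j | row j b != 0]].
Proof.
apply/seteqP; split=> s /=; last first.
  by case=> j bj <-; split; [right; exists j|rewrite span_dim_ray ?realmx_eq0].
case=> -[->|//]; rewrite (@span_dimE _ _ _ 1 0) ?mxrank0 // => [x /= ->|i].
  exact: sub0mx.
by exists 1; rewrite ?oner_neq0 // row0 scaler0.
Qed.

End RaysOfFans.

(** * Fibers of Phi and faces of the effective cone *)
Section Strata.
Variables (R : realType) (n k : nat) (v : 'M[int]_(k, n)).
Implicit Types (c : 'rV[int]_k) (u w y : 'rV[R]_n) (J : {set 'I_k}).

(** The admissible length in coordinate j is the distance from x_j to the ends of
    the interval [0, 1), divided by 1 + |y_j|; at x_j = 0 only the upper end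
    counts. *)
Lemma small_step (x y : 'rV[R]_k) : (forall j, 0 <= x 0 j < 1) ->
  (forall j, x 0 j = 0 -> 0 <= y 0 j) ->
  exists2 e, 0 < e & forall j, 0 <= x 0 j + e * y 0 j < 1.
Proof.
move=> x01 y0.
pose del j := if x 0 j == 0 then 1 else Num.min (x 0 j) (1 - x 0 j).
have del_gt0 j : 0 < del j.
  rewrite /del; case: eqP => // /eqP xj; have /andP[xj0 xj1] := x01 j.
  by rewrite lt_min subr_gt0 xj1 andbT lt_def xj.
have ypos j : 0 < 1 + `|y 0 j| by rewrite ltr_pwDl.
pose e := \big[Num.min/1]_j (del j / (1 + `|y 0 j|)).
have e0 : 0 < e by apply: lt_bigmin => // j _; rewrite divr_gt0.
exists e => // j.
have ey : e * `|y 0 j| < del j.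
  apply: (@lt_le_trans _ _ (e * (1 + `|y 0 j|))); first by rewrite ltr_pM2l // ltrDr.
  by rewrite -ler_pdivlMr //; apply: bigmin_le.
have := ler_norm (y 0 j); have := lerNnormlW (lexx `|y 0 j|) => ya yb.
have /andP[xj0 xj1] := x01 j; have yj := y0 j.
have h1 : e * y 0 j <= e * `|y 0 j| by rewrite ler_pM2l.
have h2 : - (e * `|y 0 j|) <= e * y 0 j by rewrite -mulrN ler_pM2l.
move: ey yj; rewrite /del; case: eqP => [xj|_] ey yj.
  have h3 : 0 <= e * y 0 j by rewrite mulr_ge0 ?yj // ltW.
  by apply/andP; split; lra.
by move: ey; rewrite lt_min => /andP[ey1 ey2]; apply/andP; split; lra.
Qed.

(** A point u in the fiber over c gives this representative of the class of c in
    the half-open unit cube; all representatives in the cube arise so. *)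
Definition gap c u : 'rV[R]_k := realmx R c - u *m phi R v.

Lemma gapE c u j : gap c u 0 j = (c 0 j)%:~R - (u *m phi R v) 0 j.
Proof. by rewrite mxE [realmx R c 0 j]mxE mxE. Qed.

Lemma clproj_phi w : clproj v (w *m phi R v) = 0.
Proof. by rewrite /clproj -mulmxA mulmx_coker mulmx0. Qed.

Lemma clproj_gap c u : clproj v (gap c u) = clproj v (realmx R c).
Proof. by rewrite /clproj mulmxBl [X in _ - X]clproj_phi subr0. Qed.

Lemma clproj_eqP (x y : 'rV[R]_k) :
  clproj v x = clproj v y <-> exists w, x - y = w *m phi R v.
Proof.
split=> [xy|[w /eqP]].
  have /submxP[w ->] : (x - y <= phi R v)%MS; last by exists w.
  by rewrite submxE mulmxBl -/(clproj v x) -/(clproj v y) xy subrr.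
by rewrite subr_eq => /eqP ->; rewrite /clproj mulmxDl [X in X + _]clproj_phi add0r.
Qed.

Lemma fiberP c u : fiber v c u <-> forall j, 0 <= gap c u 0 j < 1.
Proof.
have gapP j : (0 <= gap c u 0 j < 1) =
    ((c 0 j - 1)%:~R < (u *m phi R v) 0 j <= (c 0 j)%:~R).
  by rewrite gapE subr_ge0 ltrBlDr addrC -ltrBlDr intrB andbC.
split=> [uc j|uc]; first by rewrite gapP -(uc : Phi v u = c) mxE ceil_itv.
by apply/rowP => j; rewrite mxE; apply: ceil_def; rewrite -gapP.
Qed.

Definition tight c : {set 'I_k} :=
  [set j | `[< forall u, fiber v c u -> gap c u 0 j = 0 >]]%SET.

Lemma gap_int c u j : fiber v c u ->
  (gap c u 0 j = 0 <-> (u *m phi R v) 0 j \is a Num.int).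
Proof.
move=> uc; have -> : c = Phi v u by [].
rewrite gapE mxE intrEceil -subr_eq0; split=> [->//|/eqP].
by [].
Qed.

Lemma Jset_stratum c : Jset (@stratum R n k v c) = tight c.
Proof.
apply/setP => j; rewrite !inE; apply/asboolP/asboolP => [hS u uc|hS t [u uc <-]].
  by apply/gap_int => //; apply/h_pi_eq0/hS; exists u.
by apply/h_pi_eq0/(gap_int _ uc)/hS.
Qed.

Lemma gap_mid c u w :
  gap c (2^-1 *: (u + w)) = 2^-1 *: (gap c u + gap c w).
Proof.
apply/rowP => j; rewrite /gap -scalemxAl mulmxDl !mxE; lra.
Qed.

(** The fiber is convex: taking midpoints with one witness for each coordinate
    that is not tight makes all these coordinates positive at once. *)
Lemma fiber_interior c : @fiber R n k v c !=set0 ->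
  exists u : 'rV[R]_n, fiber v c u /\ forall j, (gap c u 0 j == 0) = (j \in tight c).
Proof.
move=> [u0 u0c].
suff H (s : seq 'I_k) : exists u, fiber v c u /\
    forall j, j \in s -> j \notin tight c -> 0 < gap c u 0 j.
  have [u [uc us]] := H (enum 'I_k); exists u; split=> // j.
  have [jt|jt] := boolP (j \in tight c).
    by move: jt; rewrite inE => /asboolP/(_ _ uc) ->; rewrite eqxx.
  by apply: gt_eqF; apply: us; rewrite // mem_enum.
elim: s => [|i s [u [uc us]]]; first by exists u0.
have [it|] := boolP (i \in tight c).
  exists u; split=> // j; rewrite inE => /predU1P[->|/us//].
  by rewrite it.
rewrite inE => /asboolPn/existsNP[w /not_implyP[wc wi]].
move/fiberP: (uc) => ug; move/fiberP: (wc) => wg.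
exists (2^-1 *: (u + w)); split=> [|j].
  apply/fiberP => j; rewrite gap_mid mxE [X in _ * X]mxE.
  have /andP[? ?] := ug j; have /andP[? ?] := wg j.
  by apply/andP; split; lra.
have /andP[uj0 _] := ug j; have /andP[wj0 _] := wg j.
rewrite gap_mid mxE [X in _ * X]mxE inE => /predU1P[ji _|js jt].
  have : 0 < gap c w 0 j by rewrite lt_def wj0 andbT ji; apply/eqP.
  lra.
by have := us j js jt; lra.
Qed.

(** From a relatively interior point, any direction that does not decrease the
    tight coordinates of the gap can be followed for a short time. *)
Lemma fiber_move c u y : fiber v c u ->
  (forall j, (gap c u 0 j == 0) = (j \in tight c)) ->
  (forall j, j \in tight c -> 0 <= (y *m phi R v) 0 j) ->
  exists2 e, 0 < e & fiber v c (u - e *: y).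
Proof.
move=> uc ut y0; have [||e e0 eP] := @small_step (gap c u) (y *m phi R v).
- exact/fiberP.
- by move=> j /eqP; rewrite ut; apply: y0.
exists e => //; apply/fiberP => j.
suff -> : gap c (u - e *: y) 0 j = gap c u 0 j + e * (y *m phi R v) 0 j by [].
by rewrite !gapE mulmxBl -scalemxAl !mxE; lra.
Qed.

(** Otherwise a short step from an interior point stays in the fiber and makes a
    tight coordinate of the gap positive. This rigidity of the tight coordinates
    is what makes the tight set determine a face of the effective cone. *)
Lemma tight_recession c y : @fiber R n k v c !=set0 ->
  (forall j, j \in tight c -> 0 <= (y *m phi R v) 0 j) ->
  forall j, j \in tight c -> (y *m phi R v) 0 j = 0.
Proof.
move=> /fiber_interior[u [uc ut]] y0 j jt.
have [e e0 ec] := fiber_move uc ut y0.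
have := jt; rewrite inE => /asboolP tP.
have E1 := tP _ ec; have E2 := tP _ uc.
have /eqP : e * (y *m phi R v) 0 j = 0.
  by move: E1 E2; rewrite !gapE mulmxBl -scalemxAl !mxE; lra.
by rewrite mulf_eq0 gt_eqF //= => /eqP.
Qed.

(** Near an interior point the fiber is open in a translate of the space of all w
    orthogonal to the tight vectors. *)
Lemma affdim_fiber c p (M : 'M[R]_(p, n)) : @fiber R n k v c !=set0 ->
  (forall w, (w <= M)%MS <-> forall j, j \in tight c -> (w *m phi R v) 0 j = 0) ->
  affdim (@fiber R n k v c) = \rank M.
Proof.
move=> c0 MP; apply: span_dimE => [_ [x xc [y yc <-]]|i].
  apply/MP => j; rewrite inE => /asboolP tP; rewrite mulmxBl.
  have := tP _ xc; have := tP _ yc; rewrite !gapE !mxE; lra.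
have [u [uc ut]] := fiber_interior c0.
have [|e e0 ec] := @fiber_move c u (row i M) uc ut.
  by move=> j jt; rewrite ((MP _).1 (row_sub i M) j jt).
exists e; first by rewrite gt_eqF.
exists u => //; exists (u - e *: row i M) => //.
by rewrite opprB addrC subrK.
Qed.

(** The class of c is the image of a point of the cube whose coordinates are zero
    exactly at the tight indices. A face that contains it therefore contains the
    images of the other basis vectors. Conversely, the cone which these generate
    is a face: if x + y is equivalent to a point supported off the tight set, the
    difference is phi(w) with phi(w) >= 0 at the tight indices, and rigidity
    forces x and y to vanish there. *)
Lemma min_faceE c tau : @fiber R n k v c !=set0 ->
  min_face tau (Eff v) (clproj v (realmx R c)) ->
  tau = [set clproj v (x *m inclmx (~: tight c)) |
          x in [set x : 'rV_#|~: tight c| | forall i, 0 <= x 0 i]].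
Proof.
move=> c0 [[tauE tau0 tauD tauZ tauF] tauc taumin].
have [u [uc ut]] := fiber_interior c0; have ug := (fiberP c u).1 uc.
have incl_ge0 (x : 'rV[R]_#|~: tight c|) : (forall i, 0 <= x 0 i) ->
    forall j, 0 <= (x *m inclmx (~: tight c)) 0 j.
  move=> x0 j; have [jt|jt] := boolP (j \in tight c).
    by rewrite mul_incl_out // inE negbK.
  have [i ->] : exists i : 'I_#|~: tight c|, j = enum_val i.
    by apply: mem_enum_val; rewrite inE.
  by rewrite mul_incl_val; apply: x0.
have supp_tight (z : 'rV[R]_k) : (forall j, j \in tight c -> z 0 j = 0) ->
    z = z *m (inclmx (~: tight c))^T *m inclmx (~: tight c).
  move=> z0; rewrite incl_support // => i j; rewrite inE negbK ord1; exact: z0.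
apply/seteqP; split.
- apply: taumin; last first.
    exists (gap c u *m (inclmx (~: tight c))^T).
      by move=> i; rewrite mul_incl_tr; case/andP: (ug (enum_val i)).
    rewrite -supp_tight ?clproj_gap // => j; rewrite -ut; exact/eqP.
  split.
  + by move=> _ [x x0 <-]; exists (x *m inclmx (~: tight c)) => //; exact: incl_ge0.
  + by exists 0 => [i|]; rewrite ?mxE // /clproj !mul0mx.
  + move=> _ _ [x x0 <-] [y y0 <-]; exists (x + y); last by rewrite /clproj !mulmxDl.
    by move=> i; rewrite mxE addr_ge0.
  + move=> a _ ha [x x0 <-]; exists (a *: x); last by rewrite /clproj -!scalemxAl.
    by move=> i; rewrite mxE mulr_ge0.
  + move=> _ _ [x x0 <-] [y y0 <-] [z z0 zxy].
    have /clproj_eqP[w wE] : clproj v (x + y) = clproj v (z *m inclmx (~: tight c)).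
      by rewrite zxy /clproj mulmxDl.
    have wxy j : j \in tight c -> (w *m phi R v) 0 j = x 0 j + y 0 j.
      move=> jt; rewrite -wE mxE [X in X + _]mxE [X in _ + X]mxE.
      by rewrite mul_incl_out ?subr0 // inE negbK.
    have xy0 j : j \in tight c -> x 0 j = 0 /\ y 0 j = 0.
      move=> jt; have : x 0 j + y 0 j = 0.
        rewrite -wxy //; apply: (tight_recession c0) => // i it.
        by rewrite wxy // addr_ge0.
      by move/eqP; rewrite paddr_eq0 // => /andP[/eqP ? /eqP ?].
    split.
      exists (x *m (inclmx (~: tight c))^T); first by move=> i; rewrite mul_incl_tr.
      by rewrite -supp_tight // => j /xy0[].
    exists (y *m (inclmx (~: tight c))^T); first by move=> i; rewrite mul_incl_tr.
    by rewrite -supp_tight // => j /xy0[].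
- move=> _ [x x0 <-].
  have gen j : j \notin tight c -> tau (clproj v (delta_mx 0 j)).
    move=> jt; have gj : 0 < gap c u 0 j.
      by have /andP[g0 _] := ug j; rewrite lt_def g0 andbT ut.
    have [] // := tauF (clproj v (gap c u 0 j *: delta_mx 0 j))
                    (clproj v (gap c u - gap c u 0 j *: delta_mx 0 j)).
    + exists (gap c u 0 j *: delta_mx 0 j) => // i.
      by rewrite mxE [X in _ * X]mxE mulr_ge0 ?ler0n // ltW.
    + exists (gap c u - gap c u 0 j *: delta_mx 0 j) => // i.
      rewrite mxE [X in _ + X]mxE [X in _ - X]mxE [X in _ - _ * X]mxE eqxx /=.
      by have [->|_] := eqVneq i j; rewrite ?mulr1 ?subrr // mulr0 subr0;
        case/andP: (ug i).
    + by rewrite /clproj -mulmxDl addrC subrK [_ *m _]clproj_gap.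
    move=> tauj _; rewrite -[delta_mx 0 j](scalerK (lt0r_neq0 gj)).
    rewrite /clproj -scalemxAl; apply: tauZ => //.
    by rewrite invr_ge0 ltW.
  rewrite /clproj [x]row_sum_delta mulmx_suml mulmx_suml.
  elim/big_ind: _ => // i _; rewrite -!scalemxAl; apply: tauZ => //.
  have -> : delta_mx 0 i *m inclmx (~: tight c) =
      delta_mx 0 (enum_val i) :> 'rV[R]_k.
    by rewrite -rowE; apply/rowP => j; rewrite !mxE eq_sym.
  by apply: gen; have := enum_valP i; rewrite inE.
Qed.

(** Rank-nullity for the restriction of clproj to R^A: its kernel consists of the
    phi(w) supported on A, and phi is injective because the v_j span. *)
Lemma rank_clproj_incl (A : {set 'I_k}) p (M : 'M[R]_(p, n)) :
  row_full (realmx R v) ->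
  (forall w, (w <= M)%MS <-> forall j, j \notin A -> (w *m phi R v) 0 j = 0) ->
  (\rank (inclmx A *m cokermx (phi R v)) + \rank M)%N = #|A|.
Proof.
move=> vfull MP.
have phif : row_free (phi R v) by rewrite /row_free /phi mxrank_tr.
have -> : \rank M = \rank (inclmx A :&: kermx (cokermx (phi R v)))%MS.
  rewrite -(mxrankMfree _ phif); apply/eqmx_rank/andP; split.
    rewrite sub_capmx; apply/andP; split.
      apply/row_subP => i; rewrite row_mul.
      rewrite -(@incl_support _ _ A _ (row i M *m phi R v)) ?submxMl //.
      by move=> j l lA; rewrite ord1; apply: (MP _).1 lA; exact: row_sub.
    by apply/sub_kermxP; rewrite -mulmxA mulmx_coker mulmx0.
  apply/row_subP => i; set x := row i _.
  have : (x <= inclmx A :&: kermx (cokermx (phi R v)))%MS by exact: row_sub.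
  rewrite sub_capmx => /andP[/submxP[z zE] /sub_kermxP/eqP].
  rewrite -submxE => /submxP[w wE]; rewrite wE submxMr //.
  by apply/MP => j jA; rewrite -wE zE mul_incl_out.
rewrite mxrank_mul_ker; apply/eqP; rewrite -/(row_free _).
by apply/row_freeP; exists (inclmx A)^T; rewrite incl_inclT.
Qed.

End Strata.

(** * The quotient by the span of the tight rays *)
Section Quotient.
Variables (R : realType) (n k : nat) (v : 'M[int]_(k, n)) (J : {set 'I_k}).
Variable Q : quotient_splitting (inclmx J *m v).

Local Notation a := (qs_a Q).
Local Notation q := (qs_q Q).
Local Notation p := (qs_p Q).
Local Notation E := (inclmx (~: J)).
Local Notation A := (inclmx J *m v).

Definition quotient_stack : toric_stack R (qs_r Q) #|~: J| :=
  @ToricStack R _ _ _ a (rows_off v J *m q) (rows_off v J *m p)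
    (ray_fan (rows_off v J *m q)) (@qs_a_gt1 _ _ _ Q)
    (ray_fan_is_fan _ _) (ray_fan_rays _ _).

Local Notation b := (ts_b quotient_stack).
Local Notation t := (ts_t quotient_stack).

Lemma ts_bE : b = E *m v *m q. Proof. by rewrite /= /rows_off rowsubE. Qed.
Lemma ts_tE : t = E *m v *m p. Proof. by rewrite /= /rows_off rowsubE. Qed.

Lemma quotient_stackP : is_quotient_stack v quotient_stack.
Proof.
exists q, p; split=> //= [y z|x].
  exists (y *m qs_Xq Q + z *m qs_Xp Q), 0.
  rewrite !mulmxDl -!mulmxA qs_Xqq qs_Xqp qs_Xpq qs_Xpp.
  by rewrite !mulmx1 !mulmx0 mul0mx !addr0 add0r.
split=> [[xq [w xp]]|[c c0 ->]].
  exists ((w *m qs_D Q + x *m qs_C Q) *m inclmx J).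
    by move=> j jJ; rewrite mul_incl_out.
  rewrite -[LHS]mulmx1 -(qs_1 Q) !mulmxDr !mulmxA xq xp mul0mx add0r.
  by rewrite -(mulmxA w) qs_aX !mulmxDl !mulmxA.
have cE : c *m v = c *m (inclmx J)^T *m A.
  by rewrite mulmxA incl_support // => i j; rewrite ord1; exact: c0.
rewrite cE -!(mulmxA _ A) qs_Aq qs_Ap mulmx0; split=> //.
by exists (c *m (inclmx J)^T *m qs_W Q); rewrite !mulmxA.
Qed.

(** A real linear form w on Z^n is determined by its values on the lifted
    generators of the quotient and on the rows of A. *)
Lemma real_decomposition (w : 'rV[R]_n) :
  w = w *m realmx R (qs_Xq Q)^T *m realmx R q^T
    + w *m realmx R (qs_Xp Q)^T *m realmx R p^T
    + w *m realmx R A^T *m realmx R (qs_C Q)^T.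
Proof.
rewrite -!mulmxA -!mulmxDr -!realmxM -!trmx_mul -!realmxD -!linearD /= qs_1.
by rewrite trmx1 realmx1 mulmx1.
Qed.

(** Multiples of the torsion generators lie in the span of A, so the values of a
    linear form on them are determined by its values on A. *)
Lemma real_torsion (w : 'rV[R]_n) :
  w *m realmx R (qs_Xp Q)^T *m realmx R (diag_mx a) =
  w *m realmx R A^T *m realmx R (qs_D Q)^T.
Proof.
rewrite -!mulmxA -!realmxM; congr (_ *m realmx R _).
by rewrite -trmx_mul -qs_aX trmx_mul tr_diag_mx.
Qed.

Lemma diag_a_inj m : injective (fun y : 'M[R]_(m, _) => y *m realmx R (diag_mx a)).
Proof.
move=> y z; rewrite /Defs.realmx map_diag_mx !mul_mx_diag => /matrixP yz.
apply/matrixP => i j; have := yz i j; rewrite !mxE; apply: mulIf.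
by rewrite intr_eq0 gt_eqF // (lt_trans _ (qs_a_gt1 j)).
Qed.

Lemma mul_phi_J m (w : 'M[R]_(m, n)) i l :
  (w *m phi R v) i (enum_val l) = (w *m realmx R A^T) i l.
Proof.
rewrite -mul_incl_tr -mulmxA phiE -(map_incl R) realmx_tr -realmxM.
by rewrite trmx_mul.
Qed.

(** The dual of the quotient lattice: linear forms vanishing on v_j for all j in J
    factor through the free part Z^r. *)
Lemma orthogonal_span (w : 'rV[R]_n) :
  (w <= realmx R q^T)%MS <-> forall j, j \in J -> (w *m phi R v) 0 j = 0.
Proof.
split=> [/submxP[y ->] j jJ|wJ].
  have [l ->] := mem_enum_val jJ; rewrite mul_phi_J -mulmxA -realmxM.
  by rewrite -trmx_mul qs_Aq trmx0 realmx0 mulmx0 mxE.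
have wA : w *m realmx R A^T = 0.
  by apply/rowP => l; rewrite -mul_phi_J wJ ?enum_valP // mxE.
have wX : w *m realmx R (qs_Xp Q)^T = 0.
  by apply: diag_a_inj; rewrite /= real_torsion wA !mul0mx.
by rewrite (real_decomposition w) wA wX !mul0mx !addr0 submxMl.
Qed.

Lemma rank_orthogonal : \rank (realmx R q^T) = qs_r Q.
Proof.
apply/eqP/row_freeP; exists (realmx R (qs_Xq Q)^T).
by rewrite -realmxM -trmx_mul qs_Xqq trmx1 realmx1.
Qed.

Lemma phi_support m (w : 'M[R]_(m, n)) : (w <= realmx R q^T)%MS ->
  w *m phi R v *m E^T *m E = w *m phi R v.
Proof.
move=> /row_subP wq; apply: incl_support => i j; rewrite inE negbK => jJ.
have := (orthogonal_span _).1 (wq i) j jJ; rewrite -row_mul mxE //.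
Qed.

Lemma phi_b : phi R b = realmx R q^T *m phi R v *m E^T.
Proof.
by rewrite !phiE ts_bE -(map_incl R) realmx_tr -!realmxM !trmx_mul mulmxA.
Qed.

Lemma extend0E (x : 'rV[R]_#|~: J|) : extend0 x = x *m E.
Proof.
rewrite [x in RHS]row_sum_delta mulmx_suml; apply: eq_bigr => i _.
rewrite -scalemxAl; congr (_ *: _); rewrite -rowE.
by apply/rowP => j; rewrite !mxE eq_sym.
Qed.

(** If x extended by zero equals phi(w), then w is orthogonal to v_j for all j in
    J, so it comes from the dual of the quotient lattice and x is the image of
    that form. *)
Lemma clproj_b_eq0 (x : 'rV[R]_#|~: J|) :
  clproj b x = 0 <-> clproj v (x *m E) = 0.
Proof.
rewrite /clproj; split=> /eqP; rewrite -submxE => /submxP[w wE]; apply/eqP;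
    rewrite -submxE.
  rewrite wE phi_b !mulmxA phi_support ?submxMl //.
have /submxP[y yE] : (w <= realmx R q^T)%MS.
  by apply/orthogonal_span => j jJ; rewrite -wE mul_incl_out // inE negbK.
have -> : x = x *m E *m E^T by rewrite -mulmxA incl_inclT mulmx1.
by rewrite wE yE phi_b -!mulmxA submxMl.
Qed.

(** Extension by zero descends to the cokernels; since cokermx realises these
    inside coordinate spaces, pinvmx chooses the representative to extend. *)
Definition iota_mx : 'M[R]_(#|~: J|, k) :=
  pinvmx (cokermx (phi R b)) *m E *m cokermx (phi R v).

Lemma clproj_iota (x : 'rV[R]_#|~: J|) :
  clproj b x *m iota_mx = clproj v (x *m E).
Proof.
set C := cokermx (phi R b); pose z := x *m C *m pinvmx C - x.
have : clproj b z = 0 by rewrite /clproj mulmxBl mulmxKpV ?submxMl // subrr.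
move/clproj_b_eq0; rewrite /clproj !mulmxBl => /eqP; rewrite subr_eq0 => /eqP <-.
by rewrite /iota_mx !mulmxA.
Qed.

Lemma iota_inj (x : 'rV[R]_#|~: J|) :
  clproj b x *m iota_mx = 0 -> clproj b x = 0.
Proof. by rewrite clproj_iota => /clproj_b_eq0. Qed.

Lemma Eff_quotient_stack : Eff_identified v quotient_stack
  [set clproj v (x *m E) | x in [set x : 'rV_#|~: J| | forall i, 0 <= x 0 i]].
Proof.
exists iota_mx; split=> [x||].
- by rewrite clproj_iota extend0E.
- exact: iota_inj.
apply/seteqP; split=> [_ [_ [x x0 <-] <-]|_ [x x0 <-]].
  by exists x; rewrite ?clproj_iota.
by exists (clproj b x); [exists x|rewrite clproj_iota].
Qed.

(** * Class groups *)
Local Notation relations := (block_mx b^T 0 t^T (diag_mx a)).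

(** The homomorphism of class groups Gale dual to Z^n -> N'. A pair (c, z) goes to
    c off J; on J its values come from z alone, where W records the coordinates
    with respect to the moduli of the v_j in J, which are zero in N'. *)
Definition cl_mx : 'M[int]_(#|~: J| + qs_s Q, k) :=
  col_mx E ((qs_W Q)^T *m inclmx J).

Lemma rel_cl_mx : relations *m cl_mx = col_mx q^T p^T *m v^T.
Proof.
have vE : v^T = v^T *m E^T *m E + v^T *m (inclmx J)^T *m inclmx J.
  by rewrite -!mulmxA -mulmxDr [E^T *m E + _]addrC incl_decomp mulmx1.
rewrite /cl_mx mul_block_col mul0mx addr0 ts_bE ts_tE mul_col_mx; congr col_mx.
  rewrite [in RHS]vE mulmxDr !mulmxA -(mulmxA q^T v^T (inclmx J)^T) -!trmx_mul.
  by rewrite qs_Aq trmx0 mul0mx addr0 !mulmxA.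
rewrite [in RHS]vE mulmxDr !mulmxA -(mulmxA p^T v^T (inclmx J)^T) -!trmx_mul.
by rewrite qs_Ap !trmx_mul tr_diag_mx !mulmxA.
Qed.

Definition cl_map (th : ts_Cl quotient_stack) : Cl v :=
  \pi_(Cl v)%qT (repr th *m cl_mx).

(** Relations go to relations by the previous identity, so any representative may
    be used. *)
Lemma cl_map_pi c : cl_map (\pi_(ts_Cl quotient_stack)%qT c) =
  \pi_(Cl v)%qT (c *m cl_mx).
Proof.
have /asboolP[m e] : repr (\pi_(ts_Cl quotient_stack)%qT c) - c \in imZ relations.
  by rewrite Quotient.idealrBE reprK.
apply/eqP; rewrite /cl_map -Quotient.idealrBE -mulmxBl e -mulmxA rel_cl_mx mulmxA.
by apply/asboolP; eexists.
Qed.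

(** The vector of which ts_clR takes the class, for an arbitrary
    representative. *)
Definition cl_real (c : 'rV[int]_(#|~: J| + qs_s Q)) : 'rV[R]_#|~: J| :=
  let e : 'rV[R]_(qs_s Q) :=
    \row_i ((rsubmx c 0 i)%:~R / (a 0 i)%:~R) in
  realmx R (lsubmx c) - e *m (realmx R t)^T.

(** Over the reals (c, z) is equivalent to a vector supported off J, and cl_mx is
    then extension by zero: the two differ by phi of the real form e p^T, with
    e = z / a. *)
Lemma cl_realP c : exists2 e : 'rV[R]_(qs_s Q),
    realmx R (rsubmx c) = e *m realmx R (diag_mx a) &
    cl_real c = realmx R (lsubmx c) - e *m realmx R t^T /\
    realmx R (c *m cl_mx) = cl_real c *m E + e *m realmx R (p^T *m v^T).
Proof.
rewrite /cl_real; set e := (\row_i _).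
have eE : realmx R (rsubmx c) = e *m realmx R (diag_mx a).
  rewrite /Defs.realmx map_diag_mx mul_mx_diag; apply/rowP => i.
  by rewrite !mxE divfK // intr_eq0 gt_eqF // (lt_trans _ (qs_a_gt1 i)).
exists e => //; rewrite realmx_tr; split=> //.
have cE : c *m cl_mx =
    lsubmx c *m E + rsubmx c *m ((qs_W Q)^T *m inclmx J).
  by rewrite -[in LHS](hsubmxK c) mul_row_col.
have := rel_cl_mx; rewrite mul_block_col mul_col_mx => /eq_col_mx[_ <-].
rewrite cE !realmxD !realmxM eE map_incl !mulmxDr mulmxBl !mulmxA.
by rewrite addrA subrK.
Qed.

Lemma clR_cl_map th : clR R (cl_map th) = ts_clR th *m iota_mx.
Proof.
have [e _ [_ thE]] := cl_realP (repr th).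
rewrite [RHS]clproj_iota clR_pi; apply/clproj_eqP; exists (e *m realmx R p^T).
by rewrite thE addrC addKr realmxM mulmxA phiE.
Qed.

(** If (c, z) goes to phi(m) with m integral, then m - e p^T vanishes on v_j for
    all j in J, hence m = y q^T + e p^T. Evaluating m on the lifted generators
    shows that y and e are integral; they express (c, z) as a relation. *)
Lemma cl_map_ker c : c *m cl_mx \in imZ v^T -> c \in imZ relations.
Proof.
move=> /asboolP[m mE].
have [e zE [xE cE]] := cl_realP c.
move: cE; rewrite mE !realmxM mulmxA -phiE => /eqP.
rewrite -subr_eq -mulmxBl => /eqP cE; set w := _ - _ in cE.
have /submxP[y yE] : (w <= realmx R q^T)%MS.
  by apply/orthogonal_span => j jJ; rewrite cE mul_incl_out // inE negbK.
have wE : realmx R m = y *m realmx R q^T + e *m realmx R p^T.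
  by rewrite -yE subrK.
have y_int : y = realmx R (m *m (qs_Xq Q)^T).
  rewrite realmxM wE mulmxDl -!mulmxA -!realmxM -!trmx_mul qs_Xqq qs_Xqp.
  by rewrite trmx1 trmx0 realmx0 realmx1 mulmx1 mulmx0 addr0.
have e_int : e = realmx R (m *m (qs_Xp Q)^T).
  rewrite realmxM wE mulmxDl -!mulmxA -!realmxM -!trmx_mul qs_Xpq qs_Xpp.
  by rewrite trmx1 trmx0 realmx0 realmx1 mulmx1 mulmx0 add0r.
apply/asboolP; exists (row_mx (m *m (qs_Xq Q)^T) (m *m (qs_Xp Q)^T)).
rewrite mul_row_block mulmx0 add0r -[LHS]hsubmxK; congr row_mx; apply: (@realmx_inj R).
  have : cl_real c = y *m realmx R b^T.
    rewrite -phiE phi_b !mulmxA -yE cE.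
    by rewrite -mulmxA incl_inclT mulmx1.
  rewrite xE => /eqP; rewrite subr_eq => /eqP ->.
  by rewrite y_int e_int -!realmxM -realmxD.
by rewrite zE e_int -realmxM.
Qed.

Lemma cl_map_inj : injective cl_map.
Proof.
move=> th th' /eqP; rewrite -Quotient.idealrBE -mulmxBl => /cl_map_ker.
by rewrite Quotient.idealrBE !reprK => /eqP.
Qed.

(** Injectivity of iota lets one test membership in the zonotope of the quotient
    after extension by zero. *)
Lemma zonotope_cl_map th : ts_Theta quotient_stack th <->
  exists2 x : 'rV[R]_#|~: J|, (forall i, 0 <= x 0 i < 1) &
    clproj v (x *m E) = - clR R (cl_map th).
Proof.
rewrite clR_cl_map; split=> [[x x01 xth]|[x x01 xth]]; exists x => //.
  by rewrite -clproj_iota xth mulNmx.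
apply/eqP; rewrite -subr_eq0 opprK; apply/eqP.
have thE : ts_clR th = clproj b (cl_real (repr th)) by [].
move: xth; rewrite -clproj_iota thE => /eqP; rewrite -subr_eq0 opprK.
by rewrite /clproj -!mulmxDl => /eqP/iota_inj.
Qed.

(** Modulo phi(u) for some real u, a representative c of the class is supported
    off J. So u is integral on v_j for all j in J, and then it agrees on these
    vectors with m + (z / a) p^T for integral m and z. Hence c - phi(m) is the
    image of its part off J together with z. *)
Lemma cl_map_surj (d : Cl v) (x : 'rV[R]_#|~: J|) :
  clproj v (x *m E) = - clR R d -> exists th, cl_map th = d.
Proof.
set c := repr d.
have -> : - clR R d = clproj v (- realmx R c) by rewrite /clproj mulNmx.
move/clproj_eqP => [u]; rewrite opprK => uE.
have uA : u *m realmx R A^T = realmx R (c *m (inclmx J)^T).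
  apply/rowP => l; rewrite -mul_phi_J -uE mxE mul_incl_out ?inE ?negbK ?enum_valP //.
  by rewrite add0r mxE mxE mul_incl_tr.
set cJ := c *m (inclmx J)^T in uA.
have [m [z zW]] : exists m z, cJ = m *m A^T + z *m (qs_W Q)^T.
  exists (cJ *m (qs_C Q)^T), (cJ *m (qs_D Q)^T); apply: (@realmx_inj R).
  rewrite realmxD (realmxM R (cJ *m (qs_C Q)^T)) (realmxM R (cJ *m (qs_D Q)^T)).
  rewrite !(realmxM R cJ) -uA.
  rewrite {1}(real_decomposition u) !mulmxDl addrC; congr (_ + _).
  rewrite -2!(mulmxA _ _ (realmx R A^T)) -!realmxM -!trmx_mul qs_Aq qs_Ap.
  rewrite trmx0 realmx0 mulmx0 add0r trmx_mul tr_diag_mx realmxM mulmxA.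
  by rewrite real_torsion.
exists (\pi_(ts_Cl quotient_stack)%qT (row_mx ((c - m *m v^T) *m E^T) z)).
rewrite cl_map_pi -[RHS]reprK; apply/eqP; rewrite -Quotient.idealrBE.
apply/asboolP; exists (- m); rewrite mul_row_col mulmxA.
have -> : z *m (qs_W Q)^T = (c - m *m v^T) *m (inclmx J)^T.
  by rewrite mulmxBl -mulmxA -trmx_mul -/cJ zW addrC addKr.
rewrite -!mulmxA -mulmxDr [E^T *m E + _]addrC incl_decomp mulmx1.
by rewrite addrAC subrr add0r mulNmx.
Qed.

End Quotient.

(** * Strata whose tight set is larger *)
Section FaceStrata.
Variables (R : realType) (n k : nat) (v : 'M[int]_(k, n)).

(** Points with the same class in the torus differ by a w with phi(w) integral,
    and rounding up commutes with integral translations. *)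
Lemma stratum_class (c : 'rV[int]_k) (u : 'rV[R]_n) :
  stratum c (\pi_(torus R v)%qT u) ->
  clproj v (realmx R (Phi v u)) = clproj v (realmx R c).
Proof.
case=> w <- /eqP; rewrite -Quotient.idealrBE => /forallP wu.
apply/clproj_eqP; exists (u - w); apply/rowP => j.
have {wu} : ((u - w) *m phi R v) 0 j \is a Num.int.
  by have := wu j; rewrite -opprB mulNmx mxE rpredN.
rewrite mulmxBl mxE [X in _ + X]mxE => uw.
have ceilE : (Num.ceil ((u *m phi R v) 0 j))%:~R =
    (Num.ceil ((w *m phi R v) 0 j))%:~R + ((u *m phi R v) 0 j - (w *m phi R v) 0 j).
  by rewrite -[in LHS](subrKC ((w *m phi R v) 0 j) ((u *m phi R v) 0 j))
    ceilDrz ?uw // intrD (ceilK uw).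
have rE (y : 'rV[R]_n) :
    realmx R (Phi v y) 0 j = (Num.ceil ((y *m phi R v) 0 j))%:~R.
  by rewrite mxE [Phi v y _ _]mxE.
by rewrite mxE [X in _ + X]mxE !rE ceilE addrAC subrr add0r.
Qed.

(** If the tight set of a stratum contains J, its gap vectors are supported off J.
    Conversely, suppose that the class has one representative in the cube
    supported off J. Any other representative in the cube differs from it by some
    phi(w), which is nonnegative on J and so, by rigidity, zero there; hence J is
    contained in the tight set of the stratum. *)
Lemma face_strata (c : 'rV[int]_k) (d : Cl v) : @fiber R n k v c !=set0 ->
  Theta R v d /\ (exists2 S : set (torus R v),
      stratum_to S (- clR R d) & tight R v c \subset Jset S) <->
  exists2 x : 'rV[R]_#|~: tight R v c|, (forall i, 0 <= x 0 i < 1) &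
    clproj v (x *m inclmx (~: tight R v c)) = - clR R d.
Proof.
move=> c0; set J := tight R v c; split.
  case=> _ [S [_ [u [Su uE]]] JS].
  have ug := (@fiberP _ _ _ v (Phi v u) u).1 erefl.
  exists (gap v (Phi v u) u *m (inclmx (~: J))^T).
    by move=> i; rewrite mul_incl_tr.
  rewrite incl_support ?clproj_gap // => i j; rewrite inE negbK ord1 => jJ.
  apply/gap_int => //; apply/h_pi_eq0.
  by have := fintype.subsetP JS j jJ; rewrite inE => /asboolP; apply.
case=> x x01 xE.
have xj j : 0 <= (x *m inclmx (~: J)) 0 j < 1.
  have [jJ|jJ] := boolP (j \in J).
    by rewrite mul_incl_out ?lexx ?ltr01 // inE negbK.
  have [i ->] : exists i : 'I_#|~: J|, j = enum_val i.
    by apply: mem_enum_val; rewrite inE.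
  by rewrite mul_incl_val.
split; first by rewrite /Theta /zonotope /= -xE; exists (x *m inclmx (~: J)).
pose c' : 'rV[int]_k := - repr d.
have c'E : - clR R d = clproj v (realmx R c').
  rewrite /clR /clproj -mulNmx; congr (_ *m _).
  by apply/rowP => j; rewrite !mxE intrN.
have [w wE] := (@clproj_eqP _ _ _ _ _ _).1 (etrans xE c'E).
have wc' : fiber v c' (- w).
  apply/fiberP => j; suff -> : gap v c' (- w) = x *m inclmx (~: J) by [].
  by rewrite /gap mulNmx opprK -wE addrC subrK.
exists (stratum c'); last first.
  rewrite Jset_stratum; apply/fintype.subsetP => j jJ.
  rewrite inE; apply/asboolP => u uc'.
  have gE i : gap v c' u 0 i =
      (x *m inclmx (~: J)) 0 i + ((- w - u) *m phi R v) 0 i.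
    have -> : gap v c' u = x *m inclmx (~: J) + (- w - u) *m phi R v.
      by rewrite mulmxBl mulNmx -wE opprB addrA subrKC.
    exact: mxE.
  have J0 i : i \in J -> gap v c' u 0 i = ((- w - u) *m phi R v) 0 i.
    by move=> iJ; rewrite gE mul_incl_out ?add0r // inE negbK.
  rewrite J0 //; apply: (tight_recession c0) => // i iJ.
  by rewrite -J0 //; have /andP[] := (@fiberP _ _ _ v c' u).1 uc' i.
split; first by exists c' => //; exists (- w).
by exists (- w); split; [exists (- w)|rewrite c'E (wc' : Phi v _ = _)].
Qed.

End FaceStrata.

Theorem corollary2 (R : realType) (n k : nat) (Sigma : set (set 'rV[R]_n))
    (v : 'M[int]_(k, n))
    (fanS : is_fan Sigma) (simplS : simplicial Sigma)
    (semiS : semiprojective Sigma) (raysS : ray_generators Sigma v)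
    (d : Cl v) (dTheta : Theta R v (- d))
    (tau : set 'rV[R]_k) (tauP : min_face tau (Eff v) (clR R d))
    (S : set (torus R v)) (SP : stratum_to S (clR R d)) :
  (span_dim tau + stratum_dim S)%N = (k - #|Jset S|)%N /\
  exists X' : toric_stack R (stratum_dim S) #|~: Jset S|,
    [/\ is_quotient_stack v X',
        Eff_identified v X' tau &
        exists f : ts_Cl X' -> Cl v,
          set_bij (ts_Theta X')
            [set th | Theta R v th /\
               exists2 S' : set (torus R v),
                 stratum_to S' (- clR R th) & Jset S \subset Jset S']
            f].
Proof.
case: SP => -[c1 c1_ex ->{S}] [u [Su uE]].
set S := stratum c1; rewrite /stratum_dim; set c := xget _ _.
(* stratum_dim refers to this choice of c, which need not be the one that
   presents S as a stratum; from here on it is used for everything. *)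
have [c_ex SE] : @fiber R n k v c !=set0 /\ S = stratum c.
  apply: (@xgetPex _ 0 [set c | @fiber R n k v c !=set0 /\ S = stratum c]).
  by exists c1.
have dE : clR R d = clproj v (realmx R c).
  by rewrite -uE; apply: stratum_class; rewrite -SE.
rewrite SE Jset_stratum.
have [Q] := quotient_splitting_exists (inclmx (tight R v c) *m v).
have dimS : affdim (@fiber R n k v c) = qs_r Q.
  by rewrite (affdim_fiber c_ex (orthogonal_span Q)) rank_orthogonal.
have tauE := min_faceE c_ex; rewrite -dE in tauE; rewrite (tauE _ tauP).
rewrite dimS; split.
  rewrite (@span_dimE _ _ _ _ (inclmx (~: tight R v c) *m cokermx (phi R v))).
  - have vfull := ray_generators_full fanS simplS semiS raysS.
    rewrite -(rank_orthogonal R Q) rank_clproj_incl //.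
      have := cardsC (tight R v c); rewrite card_ord => kE.
      by rewrite -[X in (X - _)%N]kE addKn.
    move=> w; rewrite orthogonal_span; split=> wJ j; last first.
      by move=> jJ; apply: wJ; rewrite inE negbK.
    by rewrite inE negbK; apply: wJ.
  - by move=> _ [x _ <-]; rewrite /clproj -mulmxA submxMl.
  move=> i; exists 1; rewrite ?oner_neq0 // scale1r; exists (delta_mx 0 i).
    by move=> j; rewrite mxE ler0n.
  by rewrite /clproj -mulmxA -rowE.
exists (quotient_stack R Q); split.
- exact: quotient_stackP.
- exact: Eff_quotient_stack.
exists (@cl_map R n k v _ Q); split.
- by move=> th /zonotope_cl_map ?; apply/face_strata.
- by move=> th th' _ _ /cl_map_inj.
move=> th /face_strata[//|x x01 xE]; have [th' th'E] := cl_map_surj Q xE.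
by exists th' => //; apply/zonotope_cl_map; exists x; rewrite ?th'E.
Qed.
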